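(* Let $Y=(y^{(1)},\dots,y^{(n)})$ be uniformly distributed on $\{-1,+1\}^n$, let $\eta^{(1)},\dots,\eta^{(n)}$ be i.i.d. $\mathcal{N}(0,\sigma_\eta^2)$ independent of $Y$, and release $Y_\eta=(y^{(1)}+\eta^{(1)},\dots,y^{(n)}+\eta^{(n)})$ (together with fixed, non-random design vectors $x^{(i)}$). If $\gamma\in(0,1)$ satisfies $\gamma\le1-\frac{2}{n}$ and $$\sigma_\eta^2\ge\frac{8}{(1-\gamma)\log2},$$ then $$\inf_{\mathcal{A}}\mathbb{P}_{Y,\eta}\big[\mathcal{A}(Y_\eta)\neq Y\big]\ge\gamma,$$ where the infimum is over all maps $\mathcal{A}:\mathbb{R}^n\to\{-1,+1\}^n$.
   Context: This is the perturbation of the responses in generalized linear models (and nonparametric generalized regression) with fixed design and sufficient statistic $t(y)=y$. Logarithms are natural. *)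

(* Defs.v *)
From HB Require Import structures.
From mathcomp Require Import all_boot all_order all_algebra.
From mathcomp Require Import all_classical all_reals all_analysis.
Set Implicit Arguments. Unset Strict Implicit. Unset Printing Implicit Defensive.
Import Order.TTheory GRing.Theory Num.Theory.
Local Open Scope classical_set_scope.
Local Open Scope ring_scope.

Definition sgn {R : realType} (b : bool) : R := if b then 1 else -1.

Definition Rn_cyl {R : realType} (n : nat) : set (set ('I_n -> R)) :=
  [set C | exists (i : 'I_n) (B : set R), measurable B /\ C = [set x | B (x i)]].

Definition Rn_borel {R : realType} (n : nat) (C : set ('I_n -> R)) : Prop :=
  <<s @Rn_cyl R n >> C.

(* Mutual independence of the random vector Y (values in {-1,+1}^n) and the
   real random variables eta_1, ..., eta_n: product rule for all events
   {Y in S}, {eta_i in B_i} (taking S = setT or B_i = setT gives subfamilies). *)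
Definition mutually_indep {d} {Omega : measurableType d} {R : realType}
  (P : probability Omega R) (n : nat)
  (Y : Omega -> {ffun 'I_n -> bool}) (eta : Omega -> 'I_n -> R) : Prop :=
  forall (S : set {ffun 'I_n -> bool}) (B : 'I_n -> set R),
    (forall i, measurable (B i)) ->
    P ([set w | S (Y w)] `&` [set w | forall i, B i (eta w i)]) =
    (P [set w | S (Y w)] * \prod_(i < n) P [set w | B i (eta w i)])%E.

(* Main.v *)
Require Import Defs.
From HB Require Import structures.
From mathcomp Require Import all_boot all_order all_algebra.
From mathcomp Require Import all_classical all_reals all_analysis.
From mathcomp Require Import measurable_realfun ring lra.
Import Order.TTheory GRing.Theory Num.Theory.
Local Open Scope classical_set_scope.
Local Open Scope ring_scope.

(* The success probability of A is 2^-n * sum_y mu_y {A = y}, where mu_y is the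
   product of the laws N(y_i, sigma^2). If m dominates both densities N(1, sigma^2)
   and N(-1, sigma^2), then every mu_y is below the product measure of density m
   in each coordinate, and since the sets {A = y} are disjoint, the success
   probability is at most (|m| / 2)^n with |m| the mass of m. A combination m of
   the densities N(0), N(2), N(-2) has |m| <= 31/20 in the given range of sigma,
   and (31/40)^n <= 2/n <= 1 - gamma. Integration against a product density is
   realized by integrating out one coordinate of R^n after the other. *)

(* A copy of ['I_n -> R] that carries the pointed structure [g_sigma_algebraType] needs. *)
Definition Rn (R : realType) (n : nat) : Type := 'I_n -> R.
HB.instance Definition _ R n := gen_eqMixin (Rn R n).
HB.instance Definition _ R n := gen_choiceMixin (Rn R n).
HB.instance Definition _ R n := isPointed.Build (Rn R n) (fun=> 0).

(** * Iterated integration and product densities on R^n *)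

Section iterated_integral.
Set Implicit Arguments.
Context {R : realType} {n : nat}.
Local Notation T := (@g_sigma_algebraType (Rn R n) (@Rn_cyl R n)).
Local Notation leb := (@lebesgue_measure R).

Definition upd (k : 'I_n) (x : T) (t : R) : T :=
  fun i => if i == k then t else x i.

Lemma measurable_coord (i : 'I_n) : measurable_fun setT (fun x : T => x i).
Proof.
move=> _ B mB; rewrite setTI; apply: sub_sigma_algebra.
by exists i, B.
Qed.

Lemma measurable_to_Rn d (X : measurableType d) (f : X -> T) :
  (forall i, measurable_fun setT (fun x => f x i)) -> measurable_fun setT f.
Proof.
move=> mf; apply: (@measurability _ _ X T setT f (@Rn_cyl R n) erefl).
move=> _ [_ [i [B [mB ->]]] <-].
exact: (mf i measurableT B mB).
Qed.

Lemma measurable_upd k :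
  measurable_fun setT (fun p : T * measurableTypeR R => upd k p.1 p.2).
Proof.
apply: measurable_to_Rn => i; rewrite /upd; case: eqP => _.
  exact: measurable_snd.
by apply: (measurableT_comp (measurable_coord i)); exact: measurable_fst.
Qed.

Definition mnneg (f : T -> \bar R) :=
  measurable_fun setT f /\ forall x, (0 <= f x)%E.

Definition weight (g : 'I_n -> R -> R) :=
  forall i, measurable_fun setT (g i) /\ forall t, 0 <= g i t.

(** The result stays a function of the whole vector, although it no longer depends on coordinate
    [k]; so the operators for different coordinates compose. *)
Definition wint (g : 'I_n -> R -> R) (k : 'I_n) (f : T -> \bar R) (x : T) :=
  (\int[leb]_t ((g k t)%:E * f (upd k x t)))%E.

Definition witer g (s : seq 'I_n) (f : T -> \bar R) := foldr (wint g) f s.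

Lemma measurable_wint_integrand g k f : weight g -> mnneg f ->
  measurable_fun setT (fun p : T * measurableTypeR R =>
    ((g k p.2)%:E * f (upd k p.1 p.2))%E).
Proof.
move=> wg [mf _]; apply: emeasurable_funM.
  apply/measurable_EFinP; apply: (measurableT_comp (wg k).1).
  exact: measurable_snd.
exact: (measurableT_comp mf (measurable_upd k)).
Qed.

Lemma measurable_wint_section g k f (x : T) : weight g -> mnneg f ->
  measurable_fun setT (fun t : measurableTypeR R =>
    ((g k t)%:E * f (upd k x t))%E).
Proof.
move=> wg nf.
exact: (measurable_fun_pair2 x (measurable_wint_integrand k wg nf)).
Qed.

Lemma wint_integrand_ge0 g k f (x : T) t : weight g -> mnneg f ->
  (0 <= (g k t)%:E * f (upd k x t))%E.
Proof. by move=> wg [_ f0]; rewrite mule_ge0// lee_fin; exact: (wg k).2. Qed.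

Lemma mnneg_wint g k f : weight g -> mnneg f -> mnneg (wint g k f).
Proof.
move=> wg nf; split; last first.
  by move=> x; apply: integral_ge0 => t _; exact: wint_integrand_ge0.
apply: (measurable_fun_fubini_tonelli_F (m2 := leb)
  (fun p : T * measurableTypeR R => (g k p.2)%:E * f (upd k p.1 p.2))%E).
  exact: measurable_wint_integrand.
by move=> p; exact: wint_integrand_ge0.
Qed.

Lemma mnneg_witer g s f : weight g -> mnneg f -> mnneg (witer g s f).
Proof. by move=> wg nf; elim: s => //= k s IH; exact: mnneg_wint. Qed.

Lemma le_witer g h s f f' : weight g -> weight h ->
  (forall i t, g i t <= h i t) -> mnneg f -> mnneg f' ->
  (forall x, (f x <= f' x)%E) -> forall x, (witer g s f x <= witer h s f' x)%E.
Proof.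
move=> wg wh gh nf nf' ff'; elim: s => [|k s IH] x; first exact: ff'.
have ng := mnneg_witer s wg nf; have nh := mnneg_witer s wh nf'.
apply: ge0_le_integral => //.
- by move=> t _; exact: wint_integrand_ge0.
- exact: measurable_wint_section.
- exact: measurable_wint_section.
- move=> t _; apply: lee_pmul => //.
  + by rewrite lee_fin; exact: (wg k).2.
  + exact: ng.2.
  + by rewrite lee_fin.
  + exact: IH.
Qed.

(** Monotone convergence passes the sum through one integral at a time; this gives the
    sigma-additivity of [prod_density]. *)
Lemma witer_nneseries g s (F : nat -> T -> \bar R) : weight g ->
  (forall j, mnneg (F j)) -> forall x,
  witer g s (fun x => \sum_(j <oo) F j x)%E x = (\sum_(j <oo) witer g s (F j) x)%E.
Proof.
move=> wg nF; elim: s => //= k s IH x.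
rewrite /wint -integral_nneseries//.
- apply: eq_integral => t _; rewrite IH nneseriesZl//.
  by move=> j _; exact: (mnneg_witer s wg (nF j)).2.
- move=> j; apply: measurable_wint_section => //; exact: mnneg_witer.
- move=> j t _; apply: wint_integrand_ge0 => //; exact: mnneg_witer.
Qed.

(** Integrating out coordinate [k] turns only the factor [u k] into its integral [c k]. With
    [uniq s] that factor is still untouched when its turn comes. *)
Lemma witer_prod g s (u : 'I_n -> R -> R) (c : 'I_n -> R) : weight g ->
  weight u -> uniq s ->
  (forall i, \int[leb]_t (g i t * u i t)%:E = (c i)%:E)%E ->
  forall x, witer g s (fun x => (\prod_i u i (x i))%:E) x =
    (\prod_i (if i \in s then c i else u i (x i)))%:E.
Proof.
move=> wg wu + gu; elim: s => //= k s IH /andP[ks us] x.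
pose a := \prod_(i | i != k) (if i \in s then c i else u i (x i)).
have c0 i : 0 <= c i.
  rewrite -lee_fin -gu; apply: integral_ge0 => t _.
  by rewrite lee_fin mulr_ge0 ?(wg i).2 ?(wu i).2.
have a0 : 0 <= a.
  by apply: prodr_ge0 => i _; case: ifP => _; rewrite ?(wu i).2.
rewrite /wint.
transitivity (\int[leb]_t (a%:E * (g k t * u k t)%:E))%E.
  apply: eq_integral => t _; rewrite IH// -!EFinM; congr EFin.
  rewrite (bigD1 k)//= (negbTE ks) /upd eqxx.
  rewrite mulrA mulrC; congr *%R; apply: eq_bigr => i /negbTE ik.
  by rewrite ik.
rewrite ge0_integralZl_EFin//; last first.
- apply/measurable_EFinP; apply: measurable_funM; [exact: (wg k).1|exact: (wu k).1].
- by move=> t _; rewrite lee_fin mulr_ge0 ?(wg k).2 ?(wu k).2.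
rewrite gu -EFinM; congr EFin.
rewrite [RHS](bigD1 k)//= inE eqxx/= mulrC; congr *%R.
by apply: eq_bigr => i /negbTE ik; rewrite inE ik.
Qed.

Lemma mnneg_indic (C : set T) : measurable C -> mnneg (fun x => (\1_C x)%:E).
Proof.
move=> mC; split; last by move=> x; rewrite lee_fin.
by apply/measurable_EFinP; exact: measurable_indic.
Qed.

(* The proof that [g] is a weight is an argument only so that the measure
   structure below can be inferred. *)
Definition prod_density (g : 'I_n -> R -> R) (wg : weight g) (C : set T) :=
  witer g (enum 'I_n) (fun x => (\1_C x)%:E) (fun=> 0).

Section product_density.
Variables (g : 'I_n -> R -> R) (wg : weight g).

Local Notation nu := (prod_density wg).

Let prod_density0 : nu set0 = 0%E.
Proof.
(* The base point is generalized because the inner integrals are evaluated at updated vectors. *)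
rewrite /prod_density; move: (fun=> 0) => x0.
elim: (enum _) x0 => [|k s IH] x /=; first by rewrite indic0.
transitivity (\int[leb]_t (0%E : \bar R))%E; last exact: integral0.
by apply: eq_integral => t _; rewrite IH mule0.
Qed.

Let prod_density_ge0 C : (0 <= nu C)%E.
Proof.
rewrite /prod_density; move: (fun=> 0) => x0.
elim: (enum _) x0 => [|k s IH] x /=.
  by rewrite lee_fin.
apply: integral_ge0 => t _; apply: mule_ge0; last exact: IH.
by rewrite lee_fin; exact: (wg k).2.
Qed.

Let prod_density_sigma_additive : semi_sigma_additive nu.
Proof.
move=> F mF tF mUF.
have -> : nu (\bigcup_j F j) = (\sum_(j <oo) nu (F j))%E.
  rewrite /prod_density -witer_nneseries//; last first.
    by move=> j; exact: mnneg_indic.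
  by congr (witer _ _ _ _); apply/funext => x; exact: indic_bigcup.
apply: is_cvg_nneseries => j _ _; exact: prod_density_ge0.
Qed.

HB.instance Definition _ := isMeasure.Build _ _ _ nu
  prod_density0 prod_density_ge0 prod_density_sigma_additive.

(** The indicator of a box is the product of the indicators of its sides, so [witer_prod]
    applies. *)
Lemma prod_density_box (B : 'I_n -> set R) (c : 'I_n -> R) :
  (forall i, measurable (B i)) ->
  (forall i, \int[leb]_(t in B i) (g i t)%:E = (c i)%:E)%E ->
  nu [set x | forall i, B i (x i)] = (\prod_i c i)%:E.
Proof.
move=> mB gB; rewrite /prod_density.
rewrite (_ : (fun _ => _) = fun x : T => (\prod_i \1_(B i) (x i))%:E).
  have wB : weight (fun i => \1_(B i)).
    by move=> i; split => //; exact: measurable_indic.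
  rewrite (@witer_prod g _ (fun i => \1_(B i)) c)//.
  - by congr EFin; apply: eq_bigr => i _; rewrite mem_enum.
  - exact: enum_uniq.
  - move=> i; rewrite -gB [in RHS]integral_mkcond.
    apply: eq_integral => t _; rewrite patchE indicE.
    by case: ifP => _; rewrite ?mulr1 ?mulr0.
apply/funext => x; congr EFin; rewrite indicE.
have [/[!inE] Bx|/negP nBx] := boolP (x \in _).
  by rewrite big1// => i _; rewrite indicE mem_set//; exact: Bx.
case: (pselect (exists i, ~ B i (x i))) => [[i nB]|nB].
  by rewrite (bigD1 i)//= indicE memNset// mul0r.
exfalso; apply: nBx; rewrite inE/= => i; apply: contrapT => nBi.
by apply: nB; exists i.
Qed.

End product_density.

Lemma le_prod_density g h (wg : weight g) (wh : weight h) (C : set T) :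
  (forall i t, g i t <= h i t) -> measurable C ->
  (prod_density wg C <= prod_density wh C)%E.
Proof. by move=> gh mC; apply: le_witer => //; exact: mnneg_indic. Qed.

(** * Boxes determine finite measures on R^n *)

Definition box := [set C : set T | exists2 B : 'I_n -> set R,
  (forall i, measurable (B i)) & C = [set x | forall i, B i (x i)]].

Lemma measurable_box (C : set T) : box C -> measurable C.
Proof.
move=> [B mB ->].
rewrite (_ : [set _ | _] = \bigcap_(i in [set: 'I_n]) [set x : T | B i (x i)]).
  apply: fin_bigcap_measurable; first exact: finite_finset.
  by move=> i _; rewrite -[X in measurable X]setTI; exact: measurable_coord.
by apply/seteqP; split => x /= Bx i; [move=> _; exact: Bx|exact: Bx].
Qed.

Lemma setI_closed_box : setI_closed box.
Proof.
move=> _ _ [B mB ->] [B' mB' ->]; exists (fun i => B i `&` B' i).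
  by move=> i; exact: measurableI.
by apply/seteqP; split => [x [] Bx B'x i|x BB']; split => // i; case: (BB' i).
Qed.

Lemma box_generates (C : set T) : measurable C -> <<s box >> C.
Proof.
apply: smallest_sub; first exact: smallest_sigma_algebra.
move=> _ [i [B [mB ->]]]; apply: sub_sigma_algebra.
(* A cylinder is a box whose other sides are the whole line. *)
exists (fun j => if j == i then B else setT); first by move=> j; case: eqP.
apply/seteqP; split => x /= => [Bx j|/(_ i)]; last by rewrite eqxx.
by case: eqP => [->|].
Qed.

(** Boxes form a pi-system that generates the sigma-algebra; as [m1] is finite, the constant
    sequence [setT] serves as exhaustion. *)
Lemma measure_Rn_unique (m1 m2 : {measure set T -> \bar R}) :
  (m1 setT < +oo)%E -> (forall C, box C -> m1 C = m2 C) ->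
  forall C, measurable C -> m1 C = m2 C.
Proof.
move=> m1oo m12 C mC.
apply: (@g_sigma_algebra_measure_unique _ R T box measurable_box (fun=> setT)).
- by move=> _; exists (fun=> setT) => //; apply/seteqP; split.
- by apply/seteqP; split => // x _; exists 0%N.
- exact: setI_closed_box.
- exact: m12.
- by [].
- exact: box_generates.
Qed.

End iterated_integral.

(** * Shifted normal laws and a common dominating density *)

Section normal_shift.
Set Implicit Arguments.
Context {R : realType}.
Local Notation leb := (@lebesgue_measure R).

(** By uniqueness of Lebesgue measure, half-open intervals suffice, and translation keeps their
    length. *)
Lemma lebesgue_measure_translate (a : R) (B : set R) : measurable B ->
  pushforward leb (+%R a : R -> measurableTypeR R) B = leb B.
Proof.
move=> mB.
have ma : measurable_fun setT (+%R a : R -> measurableTypeR R).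
  exact: measurable_funD.
apply/esym/lebesgue_measure_unique => //= _ [[u v]] _ <-.
rewrite /pushforward (_ : _ @^-1` _ = `]u - a, v - a]%classic); last first.
  by apply/seteqP; split => x /=; rewrite !in_itv/=; lra.
rewrite !lebesgue_measure_itv/= !lte_fin ltrD2r -!EFinB.
by congr (if _ then _%:E else _); ring.
Qed.

Lemma normal_prob_shift (a s : R) (B : set R) : s != 0 -> measurable B ->
  normal_prob 0 s [set t | B (a + t)] = normal_prob a s B.
Proof.
move=> s0 mB.
have ma : measurable_fun setT (+%R a : R -> measurableTypeR R).
  exact: measurable_funD.
transitivity (\int[pushforward leb (+%R a : R -> measurableTypeR R)]_(t in B)
  (normal_pdf a s t)%:E)%E; last first.
  by apply: eq_measure_integral => A mA _; exact: lebesgue_measure_translate.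
rewrite ge0_integral_pushforward//.
- apply: eq_integral => t _ /=; rewrite !normal_pdfE// /normal_fun subr0.
  by rewrite addrAC subrr add0r.
- apply: measurable_funTS; apply/measurable_EFinP; exact: measurable_normal_pdf.
- by move=> t _; rewrite lee_fin normal_pdf_ge0.
Qed.

(** With [v = exp (t / s ^ 2)], the factor [exp (2 / s ^ 2)] turns the densities centred at 2 and -2
    into the centred density times [v ^ 2] and [v ^ -2]. The whole is thus the centred density times
    [3 / 4 + (v ^ 2 + v ^ -2) / 3]. *)
Definition dominating_pdf (s t : R) : R :=
  3 / 4 * normal_pdf 0 s t
  + expR (2 * s ^- 2) / 3 * (normal_pdf 2 s t + normal_pdf (- 2) s t).

(* AM-GM: [v <= 3 / 4 + v ^ 2 / 3], applied to the likelihood ratio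
   [v = exp (t / s ^ 2)] and to its inverse. *)
Lemma normal_pdf_sgn_le (s : R) (b : bool) (t : R) : 0 < s ->
  normal_pdf (sgn b) s t <= dominating_pdf s t.
Proof.
move=> s0; rewrite /dominating_pdf !normal_pdfE ?gt_eqF// /normal_fun subr0.
set pk := normal_peak s; have pk0 : 0 <= pk by exact: normal_peak_ge0.
set E := expR (- t ^+ 2 / (s ^+ 2 *+ 2)); have E0 : 0 < E by exact: expR_gt0.
pose v := expR (t * s ^- 2); have v0 : 0 < v by exact: expR_gt0.
(* The densities centred at 1 and -1 are the centred one times [v * q] and [v^-1 * q]; the factor
   [q <= 1] is then dropped. *)
pose q := expR (- s ^- 2 / 2).
have q1 : q <= 1.
  rewrite /q -[leRHS]expR0 ler_expR; have : 0 < s ^- 2 by rewrite invr_gt0 exprn_gt0.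
  lra.
have q0 : 0 < q by exact: expR_gt0.
have e1 : expR (- (t - 1) ^+ 2 / (s ^+ 2 *+ 2)) = E * v * q.
  by rewrite /E /v /q -!expRD; congr expR; field; rewrite gt_eqF.
have e2 : expR (- (t - (- 1)) ^+ 2 / (s ^+ 2 *+ 2)) = E * v^-1 * q.
  by rewrite /E /v /q -expRN -!expRD; congr expR; field; rewrite gt_eqF.
have e3 : expR (2 * s ^- 2) * expR (- (t - 2) ^+ 2 / (s ^+ 2 *+ 2)) = E * v ^+ 2.
  by rewrite /E /v (expr2 (expR _)) -!expRD; congr expR; field; rewrite gt_eqF.
have e4 : expR (2 * s ^- 2) * expR (- (t - (- 2)) ^+ 2 / (s ^+ 2 *+ 2)) = E * v^-1 ^+ 2.
  by rewrite /E /v -expRN (expr2 (expR _)) -!expRD; congr expR; field; rewrite gt_eqF.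
have amgm (z : R) : z <= 3 / 4 + z ^+ 2 / 3.
  by have := sqr_ge0 (2 * z - 3); nra.
have -> : 3 / 4 * (pk * E) + expR (2 * s ^- 2) / 3 *
   (pk * expR (- (t - 2) ^+ 2 / (s ^+ 2 *+ 2)) +
    pk * expR (- (t - (- 2)) ^+ 2 / (s ^+ 2 *+ 2))) =
  pk * (E * (3 / 4 + (v ^+ 2 + v^-1 ^+ 2) / 3)).
  transitivity (pk * (3 / 4 * E +
    (expR (2 * s ^- 2) * expR (- (t - 2) ^+ 2 / (s ^+ 2 *+ 2)) +
     expR (2 * s ^- 2) * expR (- (t - (- 2)) ^+ 2 / (s ^+ 2 *+ 2))) / 3)).
    by ring.
  by rewrite e3 e4; ring.
apply: ler_wpM2l => //.
(* Used with [z = v] for the sign +1 and [z = v^-1] for the sign -1. *)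
have dom z : 0 < z -> z ^+ 2 <= v ^+ 2 + v^-1 ^+ 2 ->
    E * z * q <= E * (3 / 4 + (v ^+ 2 + v^-1 ^+ 2) / 3).
  move=> z0 zv; rewrite -mulrA ler_pM2l//.
  apply: (@le_trans _ _ z); first by rewrite ler_piMr// ltW.
  by apply: (le_trans (amgm z)); rewrite lerD2l ler_pM2r// invr_gt0.
case: b => /=; rewrite ?e1 ?e2; apply: dom;
  by rewrite ?invr_gt0// ?lerDl ?lerDr sqr_ge0.
Qed.

Lemma measurable_dominating_pdf (s : R) : measurable_fun setT (dominating_pdf s).
Proof.
by apply: measurable_funD; apply: measurable_funM => //; try apply: measurable_funD;
  exact: measurable_normal_pdf.
Qed.

Lemma dominating_pdf_ge0 (s t : R) : 0 <= dominating_pdf s t.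
Proof.
by rewrite addr_ge0// mulr_ge0// ?addr_ge0 ?normal_pdf_ge0// divr_ge0 ?expR_ge0.
Qed.

Lemma integral_dominating_pdf (s : R) :
  (\int[leb]_t (dominating_pdf s t)%:E =
   (3 / 4 + 2 / 3 * expR (2 * s ^- 2))%:E)%E.
Proof.
have mn m : measurable_fun setT (fun t : R => (normal_pdf m s t)%:E).
  by apply/measurable_EFinP; exact: measurable_normal_pdf.
have n0 m (t : R) : (0 <= (normal_pdf m s t)%:E)%E by rewrite lee_fin normal_pdf_ge0.
have e0 : 0 <= expR (2 * s ^- 2) / 3 by rewrite divr_ge0 ?expR_ge0.
transitivity (\int[leb]_t ((3 / 4)%:E * (normal_pdf 0 s t)%:E +
  (expR (2 * s ^- 2) / 3)%:E *
    ((normal_pdf 2 s t)%:E + (normal_pdf (- 2) s t)%:E)))%E.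
  by apply: eq_integral => t _; rewrite /dominating_pdf !(EFinD, EFinM).
have m2 : measurable_fun setT (fun t : R =>
    (normal_pdf 2 s t)%:E + (normal_pdf (- 2) s t)%:E)%E by exact: emeasurable_funD.
have p2 (t : R) : (0 <= (normal_pdf 2 s t)%:E + (normal_pdf (- 2) s t)%:E)%E.
  exact: adde_ge0.
rewrite ge0_integralD//; do ?[by move=> t _; rewrite mule_ge0// lee_fin
  | by apply: measurable_funeM; exact: mn
  | by apply: measurable_funeM; exact: m2].
rewrite !ge0_integralZl_EFin//; do ?[exact: mn|exact: m2].
rewrite ge0_integralD//; do ?exact: mn.
rewrite !integral_normal_pdf -!EFinM -!EFinD; congr EFin.
by field.
Qed.

End normal_shift.

(** * Numerical estimates *)

(** The sequence [m * (31 / 40) ^ m] decreases from [m = 4] on, since [31 * (m + 1) <= 40 * m]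
    there; the values up to 4 are computed. *)
Lemma pow_le_2div (R : realType) {n : nat} : (0 < n)%N ->
  (31 / 40 : R) ^+ n <= 2 / n%:R.
Proof.
move=> n0; rewrite ler_pdivlMr ?ltr0n//.
case: n n0 => [//|[|[|[|n]]]] _; do 3?[by rewrite !exprS expr0; lra].
elim: n => [|n IH]; first by rewrite !exprS expr0; lra.
have n0 : 0 <= n%:R :> R by rewrite ler0n.
apply: le_trans IH.
rewrite !exprS; set p := _ ^+ n.
have p0 : 0 <= p by rewrite exprn_ge0//; lra.
have e1 : n.+4.+1%:R = n%:R + 5 :> R by rewrite -natrD addnC.
have e2 : n.+4%:R = n%:R + 4 :> R by rewrite -natrD addnC.
rewrite e1 e2.
have : 0 <= p * n%:R by rewrite mulr_ge0.
by nra.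
Qed.

(** As [1 - gamma < 1], the hypothesis gives [sigma ^ 2 >= 8 / ln 2], so the fourth power of the
    exponential is at most 2, while [(6 / 5) ^ 4 > 2]. *)
Lemma expR_2Vsigma2_le {R : realType} {sigma gamma : R} :
  0 < sigma -> 0 < gamma < 1 ->
  8 / ((1 - gamma) * ln 2) <= sigma ^+ 2 -> expR (2 * sigma ^- 2) <= 6 / 5.
Proof.
move=> s0 /andP[g0 g1] hs.
have l2 : 0 < ln 2 :> R by rewrite ln_gt0// ltr1n.
have ss : 0 < sigma ^+ 2 by rewrite exprn_gt0.
have h8 : 4%:R * (2 * sigma ^- 2) <= ln 2.
  have : 8 <= sigma ^+ 2 * ((1 - gamma) * ln 2).
    by rewrite -ler_pdivrMr// mulr_gt0// subr_gt0.
  move=> h; have {}h : 8 <= ln 2 * sigma ^+ 2 by nra.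
  by move: h; rewrite -ler_pdivrMr// mulrA -natrM.
have : expR (2 * sigma ^- 2) ^+ 4 <= 2.
  by rewrite -expRM_natl -[leRHS](@lnK R) ?posrE// ler_expR.
have e0 : 0 < expR (2 * sigma ^- 2) by exact: expR_gt0.
move: (expR _) e0 => z z0 z4; rewrite leNgt; apply/negP => z65.
have : (6 / 5 : R) ^+ 4 < z ^+ 4 by rewrite ltrXn2r//; lra.
by move=> h; have := lt_le_trans h z4; rewrite !exprS expr0; lra.
Qed.

(** * The joint law of labels and release, and the success probability *)

Section success_bound.
Set Implicit Arguments.
Context {R : realType} {d : measure_display} {Omega : measurableType d}.
Context {P : probability Omega R} {n : nat}.
Context {Y : Omega -> {ffun 'I_n -> bool}} {eta : Omega -> 'I_n -> R} {sigma : R}.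
Hypothesis sigma_gt0 : 0 < sigma.
Hypothesis mY : forall y, measurable [set w | Y w = y].
Hypothesis PY : forall y, P [set w | Y w = y] = ((2 ^+ n)^-1)%:E.
Hypothesis meta : forall i, measurable_fun setT (fun w => eta w i).
Hypothesis Peta : forall i (B : set R), measurable B ->
  P [set w | B (eta w i)] = normal_prob 0 sigma B.
Hypothesis indep : mutually_indep P Y eta.

Local Notation T := (@g_sigma_algebraType (Rn R n) (@Rn_cyl R n)).

(** The release with the labels frozen at [y]; it agrees with the true release on the event
    [Y = y]. *)
Let X (y : {ffun 'I_n -> bool}) (w : Omega) : T := fun i => sgn (y i) + eta w i.

Let mX y : measurable_fun setT (X y).
Proof. by apply: measurable_to_Rn => i; apply: measurable_funD. Qed.

Lemma weight_normal_pdf (y : {ffun 'I_n -> bool}) :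
  weight (fun i => normal_pdf (sgn (y i)) sigma).
Proof.
by move=> i; split; [exact: measurable_normal_pdf|exact: normal_pdf_ge0].
Qed.

Lemma weight_dominating_pdf : weight (fun _ : 'I_n => dominating_pdf sigma).
Proof.
by move=> i; split; [exact: measurable_dominating_pdf|exact: dominating_pdf_ge0].
Qed.

Let c_ge0 : 0 <= (2 ^+ n)^-1 :> R.
Proof. by rewrite invr_ge0 exprn_ge0. Qed.

Let c : {nonneg R} := NngNum c_ge0.

(** Both sides are finite measures in [C], so boxes suffice; on a box, independence splits the
    probability into that of [Y = y] and one shifted normal probability per coordinate. *)
Lemma joint_law (y : {ffun 'I_n -> bool}) (C : set T) : measurable C ->
  P ([set w | Y w = y] `&` X y @^-1` C) =
  (((2 ^+ n)^-1)%:E * prod_density (weight_normal_pdf y) C)%E.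
Proof.
move=> mC; rewrite setIC.
pose m1 := pushforward (mrestr P (mY y)) (X y).
change (m1 C = mscale c (prod_density (weight_normal_pdf y)) C).
apply: measure_Rn_unique mC.
  change (P (setT `&` [set w | Y w = y]) < +oo)%E.
  by rewrite setTI PY ltry.
move=> _ [B mB ->].
have fin i : normal_prob (sgn (y i)) sigma (B i) \is a fin_num.
  exact: (fin_num_measure (normal_prob (sgn (y i)) sigma) _ (mB i)).
have e := @prod_density_box _ _ _ (weight_normal_pdf y) B
  (fun i => fine (normal_prob (sgn (y i)) sigma (B i))) mB
  (fun i => esym (fineK (fin i))).
transitivity (((2 ^+ n)^-1)%:E *
    (\prod_i fine (normal_prob (sgn (y i)) sigma (B i)))%:E)%E; last first.
  by rewrite -e.
have mB' i : measurable [set t | B i (sgn (y i) + t)].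
  have : measurable_fun setT (+%R (sgn (y i)) : R -> measurableTypeR R).
    exact: measurable_funD.
  by move=> /(_ measurableT _ (mB i)); rewrite setTI.
have := @indep [set y] (fun i => [set t | B i (sgn (y i) + t)]) mB'.
rewrite setIC => Pbox; apply: (etrans Pbox).
rewrite [P [set w | _]]PY; congr (_ * _)%E; rewrite -prodEFin; apply: eq_bigr => i _.
by rewrite fineK// Peta// normal_prob_shift// gt_eqF.
Qed.

Lemma success_le (A : ('I_n -> R) -> {ffun 'I_n -> bool}) :
  (forall y, @Rn_borel R n [set x | A x = y]) ->
  let S := [set w | A (fun i => sgn (Y w i) + eta w i) = Y w] in
  measurable S /\
  (P S <= (((3 / 4 + 2 / 3 * expR (2 * sigma ^- 2)) / 2) ^+ n)%:E)%E.
Proof.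
move=> mA S.
pose E y := [set w | Y w = y] `&` X y @^-1` [set x | A x = y].
pose D y : set T := [set x | A x = y].
have mE y : measurable (E y).
  apply: measurableI; first exact: mY.
  by rewrite -[X in measurable X]setTI; apply: mX => //; exact: mA.
(* Success splits into disjoint events according to the true label vector. *)
have SE : S = \bigcup_(y in setT) E y.
  apply/seteqP; split => [w Sw|w [y _ [<- ]]] //.
  by exists (Y w).
have trE : trivIset setT E.
  by move=> y z _ _ [w [[<- _] [<- _]]].
have trD : trivIset setT D.
  by move=> y z _ _ [x [<- <-]].
have fT : finite_set [set: {ffun 'I_n -> bool}] by exact: finite_finset.
rewrite SE; split; first exact: fin_bigcup_measurable.
(* One measure, independent of [y], that dominates the law of the release on every event [Y = y]. *)
pose kappa : {measure set T -> \bar R} := mscale c (prod_density weight_dominating_pdf).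
have PEkappa y : (P (E y) <= kappa (D y))%E.
  rewrite /E joint_law; last exact: mA.
  apply: lee_wpmul2l; first by rewrite lee_fin.
  apply: le_prod_density; last exact: mA.
  by move=> i t; exact: normal_pdf_sgn_le.
(* The decision regions [D y] partition R^n, so their [kappa]-masses add up to the total mass. *)
apply: (@le_trans _ _ (kappa setT)).
  have -> : [set: T] = \bigcup_(y in setT) D y.
    by apply/seteqP; split => // x _; exists (A x).
  rewrite measure_fin_bigcup// (measure_fin_bigcup kappa)//; last first.
    by move=> y _; exact: mA.
  apply: lee_fsum => // y _; exact: PEkappa.
have TE : setT = [set x : T | forall i : 'I_n, setT (x i)].
  by apply/seteqP; split.
have nuT := @prod_density_box _ _ _ weight_dominating_pdf (fun=> setT)
  (fun=> 3 / 4 + 2 / 3 * expR (2 * sigma ^- 2)) (fun=> measurableT)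
  (fun=> integral_dominating_pdf sigma).
have -> : kappa setT = (((2 ^+ n)^-1)%:E *
    (\prod_(i < n) (3 / 4 + 2 / 3 * expR (2 * sigma ^- 2)))%:E)%E.
  by rewrite -nuT TE.
by rewrite -EFinM lee_fin prodr_const card_ord exprMn exprVn mulrC.
Qed.

End success_bound.

Theorem theorem6 (R : realType) (d : measure_display) (Omega : measurableType d)
  (P : probability Omega R) (n : nat)
  (Y : Omega -> {ffun 'I_n -> bool}) (eta : Omega -> 'I_n -> R)
  (sigma gamma : R) :
  (0 < n)%N ->
  0 < sigma ->
  (* Y is a measurable random vector, uniform on {-1,+1}^n *)
  (forall y, measurable [set w | Y w = y]) ->
  (forall y, P [set w | Y w = y] = ((2 ^+ n)^-1)%:E) ->
  (* eta_i are measurable, each N(0, sigma^2) *)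
  (forall i, measurable_fun setT (fun w => eta w i)) ->
  (forall i (B : set R), measurable B ->
     P [set w | B (eta w i)] = normal_prob 0 sigma B) ->
  (* Y, eta_1, ..., eta_n mutually independent *)
  mutually_indep P Y eta ->
  0 < gamma < 1 ->
  gamma <= 1 - 2 / n%:R ->
  8 / ((1 - gamma) * ln 2) <= sigma ^+ 2 ->
  forall A : ('I_n -> R) -> {ffun 'I_n -> bool},
    (forall y, @Rn_borel R n [set x | A x = y]) ->
    (gamma%:E <= P [set w | A (fun i => (sgn (Y w i) + eta w i)%R) != Y w])%E.
Proof.
move=> n0 s0 mY PY meta Peta indep g01 gn hs A mA.
have [mS PS] := success_le s0 mY PY meta Peta indep A mA.
set S := [set w | _ = _] in mS PS.
rewrite (_ : [set w | _] = ~` S); last first.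
  by apply/seteqP; split => w /= => [/eqP|/eqP].
rewrite probability_setC// leeBrDl; last exact: fin_num_measure.
rewrite -leeBrDr//; apply: (le_trans PS); rewrite -EFinB lee_fin.
(* The bound on [gamma] leaves room [2 / n] for success. *)
apply: (@le_trans _ _ (2 / n%:R)); last by lra.
apply: le_trans (pow_le_2div R n0).
(* The base of the power is at most [(3 / 4 + 2 / 3 * 6 / 5) / 2 = 31 / 40]. *)
have e6 := expR_2Vsigma2_le s0 g01 hs.
apply: lerXn2r; rewrite ?nnegrE; last by lra.
- by have := expR_gt0 (2 * sigma ^- 2); lra.
- by lra.
Qed.
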